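(* For every real $\alpha \ge 1$, $$ME(\alpha)\subset MF\left(1-\tfrac1\alpha\right)\subset \Sigma^{*}\left(1-\tfrac1\alpha\right).$$ If $\alpha=1$, both inclusions are proper. If $\alpha>1$, the result is sharp: for every $\beta$ with $1-\frac1\alpha<\beta<1$ we have $ME(\alpha)\not\subset MF(\beta)$ and $ME(\alpha)\not\subset\Sigma^{*}(\beta)$.
   Context: Let $E=\{z\in\mathbb{C}: 0<|z|<1\}$. Let $\Sigma$ be the family of functions $f(z)=z^{-1}+\sum_{n=0}^{\infty}a_nz^n$ ($a_n\in\mathbb{C}$) that are analytic in $E$, with a simple pole at $z=0$. For $0\le\alpha$, $ME(\alpha)$ is the set of $f\in\Sigma$ such that $\operatorname{Re}(zf(z))>\alpha\,|z^2f'(z)+zf(z)|$ for all $z\in E$. For $0\le\alpha<1$, $MF(\alpha)$ is the set of $f\in\Sigma$ such that $\left|\frac{zf'(z)}{f(z)}+1\right|<1-\alpha$ for all $z\in E$. For $0\le\alpha<1$, $\Sigma^{*}(\alpha)$ (meromorphic starlike functions of order $\alpha$) is the set of $f\in\Sigma$ such that $\operatorname{Re}\left(\frac{zf'(z)}{f(z)}\right)<-\alpha$ for all $z\in E$. In the definitions of $MF(\alpha)$ and $\Sigma^*(\alpha)$ it is understood that $f$ has no zeros in $E$. *)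

(* Defs.v *)
From Stdlib Require Import Reals Ensembles.
From Coquelicot Require Import Coquelicot.
Open Scope R_scope.

Definition E (z : C) : Prop := 0 < Cmod z < 1.

(** Functions on [E] are represented by total functions [C -> C]; since [E] is
    open, nothing below depends on their values outside [E]. In particular
    [C_derive f z], for [z] in [E], is the complex derivative of [f] at [z]. *)

Definition Sigma (f : C -> C) : Prop :=
  (forall z : C, E z -> @ex_derive C_AbsRing C_NormedModule f z) /\
  exists a : nat -> C, forall z : C, E z ->
    @is_pseries C_AbsRing C_NormedModule a z (f z - / z)%C.

Definition ME (alpha : R) : Ensemble (C -> C) := fun f =>
  Sigma f /\
  forall z : C, E z ->
    Re (z * f z) > alpha * Cmod (z ^ 2 * C_derive f z + z * f z).

(** The non-vanishing of [f] is explicit because [Cdiv] is total. *)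

Definition MF (alpha : R) : Ensemble (C -> C) := fun f =>
  Sigma f /\
  (forall z : C, E z -> f z <> 0) /\
  forall z : C, E z -> Cmod (z * C_derive f z / f z + 1) < 1 - alpha.

Definition SigmaStar (alpha : R) : Ensemble (C -> C) := fun f =>
  Sigma f /\
  (forall z : C, E z -> f z <> 0) /\
  forall z : C, E z -> Re (z * C_derive f z / f z) < - alpha.

(* Main.v *)
(** With [g z = z f z] one has [z f' / f + 1 = z g' / g] and
    [z^2 f' + z f = z g'], so [ME alpha] says [Re g > alpha |z g'|], which forces
    [|z g' / g| < 1 / alpha].  Properness for [alpha = 1] is witnessed by
    [g = (1 + z/3)^2] (first inclusion) and [g = (1 - z)^2] (second inclusion).
    Sharpness is witnessed by [g = 1 / (1 - c z)] with [c = 1 / (1 + alpha)],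
    for which [z g' / g = c z / (1 - c z)] tends to [1 / alpha] as [z -> 1]. *)

Require Import Defs.
From Stdlib Require Import Reals Ensembles Lra Lia.
From Coquelicot Require Import Coquelicot.
Open Scope R_scope.

(** * Nonvanishing criteria; real and imaginary parts of an inverse *)

Lemma E_neq0 (z : C) : E z -> z <> 0.
Proof. intros [Hz _]. now apply Cmod_gt_0. Qed.

Lemma Cmod_lt_sum_neq0 (a b : C) : Cmod b < Cmod a -> (a + b)%C <> 0.
Proof.
intros Hlt Heq.
assert (H : a = (- b)%C).
{ replace a with ((a + b) - b)%C by ring. rewrite Heq. ring. }
rewrite H, Cmod_opp in Hlt. lra.
Qed.

Lemma Re_Cinv (w : C) : Re (/ w) = Re w / Cmod w ^ 2.
Proof. now rewrite Cmod2_alt. Qed.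

Lemma Im_Cinv (w : C) : Im (/ w) = - Im w / Cmod w ^ 2.
Proof. now rewrite Cmod2_alt. Qed.

(** * Complex derivatives of affine maps and of the inverse *)

(** Stated for any normed module because [C] is used below with two structures: [C_NormedModule],
    and [AbsRing_NormedModule C_AbsRing] for the inner map of a composition. *)
Lemma is_derive_affine {K : AbsRing} {V : NormedModule K} (a b : V) (x : K) :
  is_derive (fun y : K => plus a (scal y b)) x b.
Proof.
pattern b at 2. rewrite <- (plus_zero_l b).
apply (is_derive_plus (fun _ : K => a)); [apply is_derive_const|].
apply filterdiff_linear, is_linear_scal_l.
Qed.

(** The remainder [1/y - 1/x + (y - x)/x^2] equals [(y - x)^2 / (x^2 y)], which is quadratically
    small as long as [y] stays away from [0]. *)
Lemma is_derive_Cinv (x : C) : x <> 0 ->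
  @is_derive C_AbsRing C_NormedModule Cinv x (- / (x * x))%C.
Proof.
intros Hx.
assert (Hx' : 0 < Cmod x) by now apply Cmod_gt_0.
split.
- apply is_linear_scal_l.
- intros x0 Hx0.
  apply (is_filter_lim_locally_unique (K := C_AbsRing)
    (V := AbsRing_NormedModule C_AbsRing)) in Hx0.
  subst x0.
  intros eps.
  set (r := Cmod x).
  (* The first bound keeps [|y| > r/2]; the second then gives [|y - x| / (r^2 |y|) <= eps]. *)
  assert (Hd : 0 < Rmin (r / 2) (eps * r ^ 3 / 2)).
  { apply Rmin_pos; [unfold r; lra|].
    apply Rdiv_lt_0_compat; [|lra].
    apply Rmult_lt_0_compat; [apply cond_pos|]. now apply pow_lt. }
  exists (mkposreal _ Hd). intros y. change C in y. intros Hy.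
  assert (Hyx : Cmod (y - x) < Rmin (r / 2) (eps * r ^ 3 / 2)) by exact Hy.
  clear Hy.
  assert (H1 : Cmod (y - x) < r / 2)
    by (eapply Rlt_le_trans; [exact Hyx|apply Rmin_l]).
  assert (H2 : Cmod (y - x) < eps * r ^ 3 / 2)
    by (eapply Rlt_le_trans; [exact Hyx|apply Rmin_r]).
  assert (Hr : 0 < r) by exact Hx'.
  assert (Hy : r / 2 < Cmod y).
  { assert (T := Cmod_triangle y (- (y - x))).
    replace (y + - (y - x))%C with x in T by ring.
    rewrite Cmod_opp in T. fold r in T. lra. }
  assert (Hy0 : y <> 0) by (apply Cmod_gt_0; lra).
  change (Cmod ((/ y - / x) - (y - x) * - / (x * x)) <= eps * Cmod (y - x)).
  replace ((/ y - / x) - (y - x) * - / (x * x))%C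
    with ((y - x) * ((y - x) / (x * x * y)))%C by (field; split; assumption).
  rewrite Cmod_mult, Rmult_comm.
  apply Rmult_le_compat_r; [apply Cmod_ge_0|].
  rewrite Cmod_div by (repeat apply Cmult_neq_0; assumption).
  rewrite !Cmod_mult. fold r.
  assert (0 < r * r) by nra.
  apply Rle_div_l; [apply Rlt_gt; nra|].
  assert (0 < eps) by apply cond_pos.
  assert (0 < eps * (r * r)) by now apply Rmult_lt_0_compat.
  nra.
Qed.

(** * Geometric and affine power series; membership in [Sigma] *)

Lemma is_series_Cgeom (q : C) : Cmod q < 1 ->
  @is_series C_AbsRing C_NormedModule (fun n => pow_n (K := C_AbsRing) q n)
    (/ (1 - q))%C.
Proof.
intros Hq.
assert (Hq1 : (1 - q)%C <> 0).
{ apply Cmod_lt_sum_neq0. now rewrite Cmod_opp, Cmod_1. }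
assert (Hs : forall n,
  sum_n (G := C_NormedModule) (fun n => pow_n (K := C_AbsRing) q n) n
  = (/ (1 - q) - q ^ S n / (1 - q))%C).
{ induction n as [|n IH].
  - rewrite sum_O. change (RtoC 1 = (/ (1 - q) - q ^ 1 / (1 - q))%C).
    simpl. field. exact Hq1.
  - rewrite sum_Sn, IH.
    change ((/ (1 - q) - q ^ S n / (1 - q)) + q ^ S n
            = / (1 - q) - q ^ S (S n) / (1 - q))%C.
    simpl. field. exact Hq1. }
apply filterlim_locally. intros eps.
assert (Hm : 0 < Cmod (1 - q)) by now apply Cmod_gt_0.
(* The error of the [n]-th partial sum is [|q|^(n+1) / |1 - q|], so the tolerance for the powers
   absorbs the denominator. *)
assert (He : 0 < eps * Cmod (1 - q))
  by (apply Rmult_lt_0_compat; [apply cond_pos|exact Hm]).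
assert (Hl := is_lim_seq_geom (Cmod q)).
rewrite (Rabs_pos_eq _ (Cmod_ge_0 q)) in Hl. specialize (Hl Hq).
(* The sum up to index [n] leaves the power [n + 1], hence the shift. *)
apply is_lim_seq_incr_1 in Hl.
apply is_lim_seq_spec in Hl.
destruct (Hl (mkposreal _ He)) as [N HN].
exists N. intros n Hn. specialize (HN n Hn). cbn [pos] in HN.
apply C_NormedModule_mixin_compat1.
rewrite Hs.
change (Cmod ((/ (1 - q) - q ^ S n / (1 - q)) - / (1 - q)) < eps).
replace ((/ (1 - q) - q ^ S n / (1 - q)) - / (1 - q))%C
  with (- (q ^ S n / (1 - q)))%C by ring.
rewrite Cmod_opp, Cmod_div, Cmod_pow by exact Hq1.
apply Rlt_div_l; [exact Hm|].
rewrite Rminus_0_r, Rabs_pos_eq in HN; [exact HN|].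
apply pow_le, Cmod_ge_0.
Qed.

Lemma is_pseries_affine (b0 b1 z : C) :
  @is_pseries C_AbsRing C_NormedModule
    (fun n => match n with 0%nat => b0 | 1%nat => b1 | _ => RtoC 0 end) z
    (b0 + b1 * z)%C.
Proof.
apply filterlim_ext_loc with (fun _ : nat => (b0 + b1 * z)%C).
(* The partial sums are constant from index 1 on. *)
- exists 1%nat. intros n Hn.
  destruct n as [|n]; [lia|]. clear Hn.
  induction n as [|n IH].
  + rewrite sum_Sn, sum_O.
    change ((b0 + b1 * z) = (1 * b0 + (z * 1) * b1))%C. ring.
  + rewrite sum_Sn, <- IH.
    match goal with |- _ = plus _ (scal ?p _) =>
      change ((b0 + b1 * z) = (b0 + b1 * z) + p * 0)%C end.
    ring.
- apply filterlim_const.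
Qed.

Lemma Sigma_intro (f df : C -> C) (a : nat -> C) :
  (forall z, E z -> @is_derive C_AbsRing C_NormedModule f z (df z)) ->
  (forall z, E z ->
     @is_pseries C_AbsRing C_NormedModule a z (f z - / z)%C) ->
  Sigma f.
Proof.
intros Hd Ha. split.
- intros z Hz. exists (df z). now apply Hd.
- now exists a.
Qed.

(** * The two inclusions *)

(** Follows from [Re w + 1 <= |w + 1|] with [w = z f'/f]. *)
Lemma MF_SigmaStar (a : R) : Included (C -> C) (MF a) (SigmaStar a).
Proof.
intros f [HS [Hnz H]]. repeat split; try apply HS; [exact Hnz|].
intros z Hz. specialize (H z Hz).
assert (T := re_le_Cmod (z * C_derive f z / f z + 1)).
rewrite re_plus, re_RtoC in T.
assert (U := Rle_abs (Re (z * C_derive f z / f z) + 1)).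
lra.
Qed.

Lemma ME_MF (alpha : R) : 1 <= alpha ->
  Included (C -> C) (ME alpha) (MF (1 - 1 / alpha)).
Proof.
intros Ha f [HS H].
(* The right-hand side of the [ME] condition is nonnegative, so [Re (z f z) > 0]; this is what
   excludes zeros of [f]. *)
assert (Hpos : forall z, E z -> 0 < Re (z * f z)).
{ intros z Hz. specialize (H z Hz).
  assert (G := Cmod_ge_0 (z ^ 2 * C_derive f z + z * f z)). nra. }
assert (Hnz : forall z, E z -> f z <> 0).
{ intros z Hz H0. specialize (Hpos z Hz).
  rewrite H0, Cmult_0_r, re_RtoC in Hpos. lra. }
repeat split; try apply HS; [exact Hnz|].
intros z Hz.
assert (Hz0 := E_neq0 z Hz). assert (Hf := Hnz z Hz).
specialize (H z Hz).
replace (z * C_derive f z / f z + 1)%C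
  with ((z ^ 2 * C_derive f z + z * f z) / (z * f z))%C by (field; split; assumption).
assert (Hzf : (z * f z)%C <> 0) by now apply Cmult_neq_0.
rewrite Cmod_div by exact Hzf.
assert (P : 0 < Cmod (z * f z)) by now apply Cmod_gt_0.
assert (T := re_le_Cmod (z * f z)).
assert (U := Rle_abs (Re (z * f z))).
replace (1 - (1 - 1 / alpha)) with (1 / alpha) by ring.
apply Rlt_div_l; [exact P|].
apply Rmult_lt_reg_l with alpha; [lra|].
replace (alpha * (1 / alpha * Cmod (z * f z))) with (Cmod (z * f z))
  by (field; lra).
lra.
Qed.

(** * Properness of both inclusions for [alpha = 1] *)

(** This is [(1 + c z)^2 / z], expanded so that removing the pole leaves an affine function. *)
Definition square_fun (c z : C) : C := (/ z + (2 * c + c * c * z))%C.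

Lemma is_derive_square_fun (c z : C) : z <> 0 ->
  @is_derive C_AbsRing C_NormedModule (square_fun c) z (- / (z * z) + c * c)%C.
Proof.
intros Hz.
apply (is_derive_plus (K := C_AbsRing) (V := C_NormedModule)
  Cinv (fun y : C => (2 * c + c * c * y)%C)).
{ now apply is_derive_Cinv. }
apply is_derive_ext with
  (fun y : C_AbsRing => plus (2 * c : C_NormedModule)%C (scal y (c * c)%C)).
{ intros y. change (2 * c + y * (c * c) = 2 * c + c * c * y)%C. ring. }
exact (is_derive_affine (V := C_NormedModule) (2 * c)%C (c * c)%C z).
Qed.

Lemma Sigma_square_fun (c : C) : Sigma (square_fun c).
Proof.
eapply Sigma_intro.
- intros z Hz. apply is_derive_square_fun. now apply E_neq0.
- intros z _.
  replace (square_fun c z - / z)%C with (2 * c + c * c * z)%C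
    by (unfold square_fun; ring).
  apply is_pseries_affine.
Qed.

Lemma mul_square_fun (c z : C) : z <> 0 ->
  (z * square_fun c z = (1 + c * z) * (1 + c * z))%C.
Proof. intros Hz. unfold square_fun. field. exact Hz. Qed.

Lemma square_fun_neq0 (c z : C) : z <> 0 -> (1 + c * z)%C <> 0 ->
  square_fun c z <> 0.
Proof.
intros Hz Hw H.
apply (Cmult_neq_0 _ _ Hw Hw).
rewrite <- mul_square_fun, H by exact Hz. ring.
Qed.

(** With [g = (1 + c z)^2], [z f'/f = z g'/g - 1 = 2 c z / (1 + c z) - 1]. *)
Lemma logderiv_square_fun (c z : C) : z <> 0 -> (1 + c * z)%C <> 0 ->
  (z * C_derive (square_fun c) z / square_fun c z
   = - ((1 - c * z) / (1 + c * z)))%C.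
Proof.
intros Hz Hw.
rewrite (is_C_derive_unique _ _ _ (is_derive_square_fun c z Hz)).
replace (square_fun c z) with ((1 + c * z) * (1 + c * z) / z)%C.
- field. now split.
- rewrite <- mul_square_fun by exact Hz. field. exact Hz.
Qed.

(** Here [z f'/f + 1 = 2 z / (3 + z)], and [|3 + z| > 2 > 2 |z|] on [E]. *)
Lemma MF_square_fun_third : MF 0 (square_fun (/ 3)).
Proof.
assert (Hw : forall z, E z -> 2 < Cmod (3 + z)).
{ intros z [_ Hz].
  assert (T := Cmod_triangle (3 + z) (- z)).
  replace (3 + z + - z)%C with (RtoC 3) in T by ring.
  rewrite Cmod_opp, Cmod_R, Rabs_pos_eq in T; lra. }
assert (H3 : RtoC 3 <> 0) by (intros H3; apply RtoC_inj in H3; lra).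
assert (Hnz : forall z, E z -> (3 + z)%C <> 0).
{ intros z Hz. apply Cmod_gt_0. specialize (Hw z Hz). lra. }
assert (Hnz' : forall z, E z -> (1 + / 3 * z)%C <> 0).
{ intros z Hz H. apply (Hnz z Hz).
  replace (3 + z)%C with (3 * (1 + / 3 * z))%C by (field; exact H3).
  rewrite H. ring. }
split; [apply Sigma_square_fun|split].
- intros z Hz. apply square_fun_neq0; [now apply E_neq0|now apply Hnz'].
- intros z Hz.
  rewrite logderiv_square_fun; [|now apply E_neq0|now apply Hnz'].
  replace (- ((1 - / 3 * z) / (1 + / 3 * z)) + 1)%C with (2 * z / (3 + z))%C
    by (field; now apply Hnz).
  rewrite Cmod_div, Cmod_mult, Cmod_R, Rabs_pos_eq by (lra || now apply Hnz).
  specialize (Hw z Hz). destruct Hz as [_ Hz].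
  apply Rlt_div_l; lra.
Qed.

Lemma not_ME_square_fun_third : ~ ME 1 (square_fun (/ 3)).
Proof.
intros [_ H].
(* Here [Re (1 + z/3)^2] falls short of [2/3 |z (1 + z/3)|] by about [0.005];
   the inequality fails only for [z] close to the unit circle. *)
set (z := ((- 0.816, 0.57) : C)).
assert (Hz2 : Cmod z ^ 2 = 0.990756) by (rewrite Cmod2_alt; simpl; lra).
assert (G := Cmod_ge_0 z).
assert (Hz : E z) by (split; nra).
assert (Hz0 := E_neq0 z Hz).
assert (H3 : RtoC 3 <> 0) by (intros H3; apply RtoC_inj in H3; lra).
specialize (H z Hz).
rewrite mul_square_fun, (is_C_derive_unique _ _ _ (is_derive_square_fun _ z Hz0))
  in H by exact Hz0.
replace (z ^ 2 * (- / (z * z) + / 3 * / 3) + (1 + / 3 * z) * (1 + / 3 * z))%C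
  with (RtoC 2 / 3 * (z * (1 + / 3 * z)))%C in H by (field; exact Hz0).
replace (1 + / 3 * z)%C with ((0.728, 0.19) : C) in H
  by (unfold z; apply injective_projections; simpl; lra).
rewrite !Cmod_mult in H.
replace (RtoC 2 / 3)%C with (RtoC (2 / 3)) in H
  by (rewrite RtoC_div; [reflexivity|lra]).
rewrite Cmod_R, Rabs_pos_eq in H by lra.
set (w := ((0.728, 0.19) : C)) in *.
assert (Hw2 : Cmod w ^ 2 = 0.566084) by (rewrite Cmod2_alt; simpl; lra).
assert (G' := Cmod_ge_0 w).
assert (HR : Re (w * w) = 0.493884) by (rewrite re_mult; simpl; lra).
rewrite HR in H.
(* The product of the moduli is known exactly only through its square, so the final comparison is
   made between squares. *)
assert (Hp : (Cmod z * Cmod w) ^ 2 = 0.990756 * 0.566084)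
  by (rewrite Rpow_mult_distr, Hz2, Hw2; reflexivity).
assert (0 <= Cmod z * Cmod w) by now apply Rmult_le_pos.
nra.
Qed.

Lemma one_minus_neq0 (z : C) : E z -> (1 + - (1) * z)%C <> 0.
Proof.
intros [_ Hz]. apply Cmod_lt_sum_neq0.
rewrite Cmod_mult, Cmod_m1, Cmod_1. lra.
Qed.

(** Here [- z f'/f] is the Möbius map [(1 + z) / (1 - z)] of the disc onto the right half-plane; its
    real part is [(1 - |z|^2) / |1 - z|^2]. *)
Lemma SigmaStar_square_fun_m1 : SigmaStar 0 (square_fun (- (1))).
Proof.
split; [apply Sigma_square_fun|split].
- intros z Hz. apply square_fun_neq0; [now apply E_neq0|now apply one_minus_neq0].
- intros z Hz. assert (Hw := one_minus_neq0 z Hz).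
  rewrite logderiv_square_fun; [|now apply E_neq0|exact Hw].
  rewrite re_opp, Ropp_0.
  apply Ropp_lt_gt_0_contravar, Rlt_gt.
  unfold Cdiv. rewrite re_mult, Re_Cinv, Im_Cinv.
  assert (P : 0 < Cmod (1 + - (1) * z) ^ 2) by now apply pow_lt, Cmod_gt_0.
  destruct Hz as [Hz0 Hz1].
  assert (Hz2 := Cmod2_alt z).
  set (m := Cmod (1 + - (1) * z) ^ 2) in *.
  assert (HRe : Re (1 - - (1) * z) = 1 + Re z) by (destruct z; simpl; ring).
  assert (HIm : Im (1 - - (1) * z) = Im z) by (destruct z; simpl; ring).
  assert (HRe' : Re (1 + - (1) * z) = 1 - Re z) by (destruct z; simpl; ring).
  assert (HIm' : Im (1 + - (1) * z) = - Im z) by (destruct z; simpl; ring).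
  rewrite HRe, HIm, HRe', HIm'.
  replace ((1 + Re z) * ((1 - Re z) / m) - Im z * (- - Im z / m))
    with ((1 - Cmod z ^ 2) / m) by (rewrite Hz2; field; lra).
  apply Rdiv_lt_0_compat; [nra|exact P].
Qed.

Lemma not_MF_square_fun_m1 : ~ MF 0 (square_fun (- (1))).
Proof.
intros [_ [_ H]].
(* At [1/2] one has [z f'/f = -3], so [|z f'/f + 1| = 2]. *)
assert (Hz : E (RtoC (1 / 2))) by (unfold E; rewrite Cmod_R, Rabs_pos_eq; lra).
specialize (H _ Hz).
rewrite logderiv_square_fun in H; [|now apply E_neq0|now apply one_minus_neq0].
replace (- ((1 - - (1) * RtoC (1 / 2)) / (1 + - (1) * RtoC (1 / 2))) + 1)%C
  with (RtoC (- 2)) in H.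
- rewrite Cmod_R, Rabs_left in H; lra.
- apply injective_projections; simpl; field.
Qed.

(** * Sharpness for [alpha > 1] *)

(** This is [1 / (z (1 - c z))] with the pole split off, which leaves the geometric series with
    coefficients [c^(n+1)]. *)
Definition geom_fun (c : R) (z : C) : C := (/ z + c * / (1 - c * z))%C.

Lemma one_minus_scal_neq0 (c : R) (z : C) : 0 <= c < 1 -> E z ->
  (1 - c * z)%C <> 0.
Proof.
intros Hc [Hz0 Hz]. apply Cmod_lt_sum_neq0.
rewrite Cmod_opp, Cmod_mult, Cmod_1, Cmod_R, Rabs_pos_eq by lra. nra.
Qed.

Lemma is_derive_geom_fun (c : R) (z : C) : z <> 0 -> (1 - c * z)%C <> 0 ->
  @is_derive C_AbsRing C_NormedModule (geom_fun c) z
    (- / (z * z) + c * c * / ((1 - c * z) * (1 - c * z)))%C.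
Proof.
intros Hz Hw.
apply (is_derive_plus (K := C_AbsRing) (V := C_NormedModule)
  Cinv (fun y : C => (c * / (1 - c * y))%C)).
{ now apply is_derive_Cinv. }
(* Regrouped to match the outer factor [c] times the chain rule for the inverse composed with
   [1 - c y]. *)
replace (c * c * / ((1 - c * z) * (1 - c * z)))%C
  with (c * (- c * (- / ((1 - c * z) * (1 - c * z)))))%C by (field; exact Hw).
apply (filterdiff_ext_lin (K := C_AbsRing) (U := AbsRing_NormedModule C_AbsRing)
  (V := C_NormedModule) _ (fun y => scal (RtoC c : C_AbsRing)
     (scal y ((- c * (- / ((1 - c * z) * (1 - c * z))))%C : C_NormedModule)))).
2: { intros y. change (c * (y * (- c * (- / ((1 - c * z) * (1 - c * z)))))
       = y * (c * (- c * (- / ((1 - c * z) * (1 - c * z))))))%C. ring. }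
apply (filterdiff_scal_r_fct (K := C_AbsRing)
  (U := AbsRing_NormedModule C_AbsRing) (V := C_NormedModule)).
{ exact Cmult_comm. }
apply (is_derive_comp (K := C_AbsRing) (V := C_NormedModule) Cinv
  (fun y : C => (1 - c * y)%C)).
{ now apply is_derive_Cinv. }
apply is_derive_ext with (fun y : C_AbsRing =>
  plus (RtoC 1 : AbsRing_NormedModule C_AbsRing) (scal y (- c)%C)).
{ intros y. change (1 + y * - c = 1 - c * y)%C. ring. }
exact (is_derive_affine (V := AbsRing_NormedModule C_AbsRing) (RtoC 1) (- c)%C z).
Qed.

Lemma Sigma_geom_fun (c : R) : 0 <= c < 1 -> Sigma (geom_fun c).
Proof.
intros Hc.
eapply Sigma_intro with (a := fun n => (c * pow_n (K := C_AbsRing) (RtoC c) n)%C).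
- intros z Hz. apply is_derive_geom_fun; [now apply E_neq0|].
  now apply one_minus_scal_neq0.
- intros z [Hz0 Hz].
  replace (geom_fun c z - / z)%C with (c * / (1 - c * z))%C
    by (unfold geom_fun; ring).
  assert (Hq : Cmod (c * z) < 1)
    by (rewrite Cmod_mult, Cmod_R, Rabs_pos_eq by lra; nra).
  assert (H := is_series_scal_l (K := C_AbsRing) (RtoC c) _ _ (is_series_Cgeom _ Hq)).
  revert H. apply is_series_ext. intros n.
  change (c * (c * z) ^ n = z ^ n * (c * c ^ n))%C.
  rewrite Cpow_mult_l. ring.
Qed.

(** After multiplication by [|1 - c z|^2] the condition reads [1 - c Re z > alpha c |z|]. It holds
    since [c Re z + alpha c |z| <= c (1 + alpha) |z| = |z| < 1]. *)
Lemma ME_geom_fun (alpha c : R) : 0 < alpha -> 0 < c -> c * (1 + alpha) = 1 ->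
  ME alpha (geom_fun c).
Proof.
intros Ha Hc Hca.
assert (Hc1 : 0 <= c < 1) by nra.
split; [now apply Sigma_geom_fun|].
intros z Hz.
assert (Hw := one_minus_scal_neq0 c z Hc1 Hz). assert (Hz0 := E_neq0 z Hz).
rewrite (is_C_derive_unique _ _ _ (is_derive_geom_fun c z Hz0 Hw)).
replace (z * geom_fun c z)%C with (/ (1 - c * z))%C
  by (unfold geom_fun; field; now split).
replace (z ^ 2 * (- / (z * z) + c * c * / ((1 - c * z) * (1 - c * z)))
         + / (1 - c * z))%C
  with (c * z / ((1 - c * z) * (1 - c * z)))%C by (field; now split).
rewrite Re_Cinv, Cmod_div, !Cmod_mult, Cmod_R, Rabs_pos_eq
  by (lra || assumption || now apply Cmult_neq_0).
replace (Re (1 - c * z)) with (1 - c * Re z) by (destruct z; simpl; ring).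
assert (P : 0 < Cmod (1 - c * z)) by now apply Cmod_gt_0.
set (m := Cmod (1 - c * z)) in *.
replace (alpha * (c * Cmod z / (m * m))) with (alpha * c * Cmod z / m ^ 2)
  by (field; lra).
apply Rlt_gt, Rmult_lt_compat_r; [apply Rinv_0_lt_compat; nra|].
assert (T := re_le_Cmod z). assert (U := Rle_abs (Re z)).
destruct Hz as [_ Hz].
assert (c * Re z <= c * Cmod z) by (apply Rmult_le_compat_l; lra).
assert (c * (1 + alpha) * Cmod z < 1) by (rewrite Hca; lra).
lra.
Qed.

Lemma not_SigmaStar_geom_fun (alpha beta c : R) :
  0 < alpha -> 0 < c -> c * (1 + alpha) = 1 -> 1 - 1 / alpha < beta < 1 ->
  ~ SigmaStar beta (geom_fun c).
Proof.
intros Ha Hc Hca Hb [_ [_ H]].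
set (d := 1 - beta).
assert (Hd : 0 < d) by (unfold d; lra).
assert (Hda : d * alpha < 1).
{ apply Rlt_div_r; [lra|]. unfold d. lra. }
(* [r] solves [c r / (1 - c r) = d]. *)
set (r := d / (c * (1 + d))).
assert (Hcr : c * r = d / (1 + d)) by (unfold r; field; lra).
assert (Hr0 : 0 < r) by (apply Rdiv_lt_0_compat; nra).
(* The claim is [d (1 - c) < c]; as [1 - c = c alpha], this is [d alpha < 1]. *)
assert (Hr1 : r < 1) by (apply Rlt_div_l; nra).
assert (Hz : E (RtoC r)) by (unfold E; rewrite Cmod_R, Rabs_pos_eq; lra).
assert (Hc1 : 0 <= c < 1) by nra.
assert (Hw := one_minus_scal_neq0 c _ Hc1 Hz). assert (Hz0 := E_neq0 _ Hz).
specialize (H _ Hz).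
rewrite (is_C_derive_unique _ _ _ (is_derive_geom_fun c _ Hz0 Hw)) in H.
assert (Hwr : 1 - c * r <> 0).
{ intros H0. apply Hw. rewrite <- RtoC_mult, <- RtoC_minus, H0. reflexivity. }
replace (geom_fun c (RtoC r)) with (/ (r * (1 - c * r)))%C in H
  by (unfold geom_fun; field; now split).
replace (r * (- / (r * r) + c * c * / ((1 - c * r) * (1 - c * r))) /
         / (r * (1 - c * r)))%C
  with (RtoC (c * r / (1 - c * r) - 1)) in H.
(* At [r] the value of [z f'/f] is exactly [d - 1 = - beta], so the strict inequality fails. *)
- rewrite re_RtoC, Hcr in H.
  replace (d / (1 + d) / (1 - d / (1 + d)) - 1) with (d - 1) in H
    by (field; lra).
  unfold d in H. lra.
- rewrite RtoC_minus, RtoC_div, RtoC_minus, RtoC_mult by exact Hwr.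
  field. now split.
Qed.

Theorem theorem2p1 (alpha : R) (halpha : 1 <= alpha) :
  Included (C -> C) (ME alpha) (MF (1 - 1 / alpha)) /\
  Included (C -> C) (MF (1 - 1 / alpha)) (SigmaStar (1 - 1 / alpha)) /\
  (alpha = 1 ->
     Strict_Included (C -> C) (ME alpha) (MF (1 - 1 / alpha)) /\
     Strict_Included (C -> C) (MF (1 - 1 / alpha)) (SigmaStar (1 - 1 / alpha))) /\
  (1 < alpha -> forall beta : R, 1 - 1 / alpha < beta < 1 ->
     ~ Included (C -> C) (ME alpha) (MF beta) /\
     ~ Included (C -> C) (ME alpha) (SigmaStar beta)).
Proof.
split; [now apply ME_MF|].
split; [apply MF_SigmaStar|].
split.
- intros ->.
  split; (split; [now apply ME_MF || apply MF_SigmaStar|]);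
    replace (1 - 1 / 1) with 0 by field; intros Heq.
  + apply not_ME_square_fun_third. rewrite Heq. apply MF_square_fun_third.
  + apply not_MF_square_fun_m1. rewrite Heq. apply SigmaStar_square_fun_m1.
- intros Ha beta Hb.
  assert (Hc : 0 < / (1 + alpha)) by (apply Rinv_0_lt_compat; lra).
  assert (Hca : / (1 + alpha) * (1 + alpha) = 1) by (field; lra).
  assert (Hin := ME_geom_fun alpha _ ltac:(lra) Hc Hca).
  assert (Hout := not_SigmaStar_geom_fun alpha beta _ ltac:(lra) Hc Hca Hb).
  (* Leaving [SigmaStar beta] refutes both inclusions, because [MF beta] lies inside it. *)
  split; intros Hincl; apply Hout.
  + apply MF_SigmaStar, Hincl, Hin.
  + apply Hincl, Hin.
Qed.
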